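(* Let $\mathbb{F}$ be a finite field whose characteristic divides $N$. Suppose that $\{C_i\}_{i=1}^r$ is a collection of $r$ mutually disconnected maximal cliques in the derangement graph $X_N$. Then the $\mathbb{F}$-linear span of $$\mathcal B=\left\{P_{nat}(1_\sigma):\sigma\in\bigcup_{i=1}^r C_i\right\}\subseteq L^2(S_N)$$ has dimension at most $(N^2-4N+r+5)/2$.
   Context: A derangement is a permutation with no fixed points. The derangement graph $X_N$ is the undirected graph with vertex set $S_N$, with an edge between $\sigma$ and $\tau$ if and only if $\sigma\tau^{-1}$ is a derangement. A clique is a set of pairwise adjacent vertices; it is maximal if it is not properly contained in another clique. Two cliques are disconnected if there is no edge between a vertex of one and a vertex of the other; a collection of cliques $C_1,\dots,C_r$ is mutually disconnected if $C_i$ and $C_j$ are disconnected for all $i\neq j$. $L^2(S_N)$ denotes the $\mathbb{F}$-vector space of all functions $S_N\to\mathbb{F}$. $1_\sigma$ is the indicator function of $\{\sigma\}$. $\pi_{nat}:S_N\to M_N(\mathbb{F})$ is the natural representation, sending a permutation to its permutation matrix. The map $P_{nat}:L^2(S_N)\to L^2(S_N)$ is $P_{nat}(f)(\tau)=\sum_{\sigma\in S_N}f(\sigma)\,\mathrm{tr}(\pi_{nat}(\sigma\tau^{-1}))$; in particular $P_{nat}(1_\sigma)(\tau)$ is the number of fixed points of $\sigma\tau^{-1}$, regarded as an element of $\mathbb{F}$. *)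

(* Defs.v *)
From mathcomp Require Import all_boot all_order all_algebra all_fingroup.

Set Implicit Arguments.
Unset Strict Implicit.
Unset Printing Implicit Defensive.

Import GRing.Theory.
Local Open Scope ring_scope.

Definition is_clique (T : finType) (e : rel T) (A : {set T}) : bool :=
  [forall x in A, forall y in A, (x != y) ==> e x y].

Definition maximal_clique (T : finType) (e : rel T) (A : {set T}) : bool :=
  maxset (is_clique e) A.

Definition disconnected (T : finType) (e : rel T) (A B : {set T}) : bool :=
  [forall x in A, forall y in B, ~~ e x y].

Definition mutually_disconnected (T : finType) (e : rel T) (r : nat)
    (C : 'I_r -> {set T}) : Prop :=
  forall i j : 'I_r, i != j -> disconnected e (C i) (C j).

Definition derangement (N : nat) (s : 'S_N) : bool := [forall i, s i != i].

(* The product of 'S_N composes from left to right, (s * t) i = t (s i), and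
   perm_mx is multiplicative for that product. *)
Definition derangement_graph (N : nat) : rel 'S_N :=
  fun s t => derangement (s * t^-1)%g.

(* F^o, rather than F, gives the function space its F-vector space structure. *)
Definition L2 (F : fieldType) (N : nat) : vectType F := {ffun 'S_N -> F^o}.

Definition indicator (F : fieldType) (N : nat) (s : 'S_N) : L2 F N :=
  [ffun t => (t == s)%:R].

Definition pi_nat (F : fieldType) (N : nat) (s : 'S_N) : 'M[F]_N := perm_mx s.

Definition P_nat (F : fieldType) (N : nat) (f : L2 F N) : L2 F N :=
  [ffun t => \sum_(s : 'S_N) f s * \tr (pi_nat F (s * t^-1)%g)].

(* Main.v *)
(* The value [P_nat 1_s t] is the pairing [<pi s, pi t>] of permutation
   matrices.  By Hall's theorem a maximal clique is a sharply transitive set,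
   so the integers [<pi s, pi t>], for [t] in [C_j], are [N] in number and sum
   to [N].  When [s] lies in another clique they are all positive, hence all
   equal to [1]; inside a clique the pairing is [0] since [N = 0] in [F].
   Differences of permutations in one clique therefore span a totally isotropic
   space orthogonal to all of [B], of codimension at most [r] in the span of
   [B].
   On the other hand the natural representation has a composition series with
   factors [1], [X] and [1], where [dim X = N - 2], so the pairing is
   [2 + tr (X s * X t^-1)] and its rank [d] is at most [(N - 2)^2 + 1].
   If [g] is the dimension sought, the isotropic part has rank at most [d - g],
   whence [g <= d - g + r]. *)
Require Import Defs.
From mathcomp Require Import all_boot all_order all_algebra all_fingroup.
From mathcomp Require Import zify lra.
Set Implicit Arguments.
Unset Strict Implicit.
Unset Printing Implicit Defensive.

Import Order.TTheory GRing.Theory Num.Theory.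
Local Open Scope ring_scope.

(** * Hall's theorem and perfect matchings of regular bipartite graphs *)

(** Induction on the total size of the sets: a set with two elements can lose one of them without
    breaking Hall's condition, and for singletons that condition is injectivity. *)
Lemma hall (I J : finType) (E : I -> {set J}) :
    (forall X : {set I}, #|X| <= #|\bigcup_(i in X) E i|)%N ->
  exists2 f : I -> J, injective f & forall i, f i \in E i.
Proof.
have [n] := ubnP (\sum_i #|E i|)%N; elim: n => // n IHn in E *.
rewrite ltnS => leEn hallE.
have [/forallP E1 | /forallPn[i]] := boolP [forall i, #|E i| <= 1]%N.
  have neE i : {j | j \in E i}.
    apply: sigW; apply/card_gt0P; have := hallE [set i].
    by rewrite big_set1 cards1.
  have Ef i : E i = [set sval (neE i)].
    by apply/esym/eqP; rewrite eqEcard sub1set (svalP (neE i)) cards1 E1.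
  exists (fun i => sval (neE i)) => [i j fij | i]; last exact: (svalP (neE i)).
  apply/eqP/negPn/negP=> neq_ij; have := hallE [set i; j].
  by rewrite bigcup_setU !big_set1 (Ef i) (Ef j) fij setUid cards1 cards2 neq_ij.
rewrite -ltnNge => /card_gt1P[x [y [Ex Ey neq_xy]]].
pose E' z := fun k => if k == i then E i :\ z else E k.
have E'S z k : E' z k \subset E k.
  by rewrite /E'; case: eqP => // ->; exact: subD1set.
have bigE' z (A : {set I}) : i \notin A ->
    \bigcup_(k in A) E' z k = \bigcup_(k in A) E k.
  move=> niA; apply: eq_bigr => k kA; rewrite /E'.
  by case: eqP => // eq_ki; rewrite -eq_ki kA in niA.
(* A set violating Hall's condition after the deletion of [z] must contain [i]; [A] is that set
   without [i], which turns the strict inequality into [<=]. *)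
have step z : z \in E i ->
    (exists2 f : I -> J, injective f & forall i, f i \in E i) \/
    (exists2 A : {set I}, i \notin A
      & #|\bigcup_(k in A) E k :|: (E i :\ z)| <= #|A|)%N.
  move=> Ez.
  have [/forallP hE' | /forallPn[X]] :=
      boolP [forall X : {set I}, #|X| <= #|\bigcup_(k in X) E' z k|]%N.
    left; have [|f injf fE] := IHn (E' z) _ hE'.
      apply: leq_trans leEn; rewrite (bigD1 i) //= [ltnRHS](bigD1 i) //=.
      rewrite -addSn leq_add //; first by rewrite /E' eqxx (cardsD1 z (E i)) Ez.
      by apply: leq_sum => k _; exact: subset_leq_card.
    by exists f => // k; exact: (subsetP (E'S z k)).
  rewrite -ltnNge => ltX; right.
  have iX : i \in X.
    by apply: contraLR ltX => niX; rewrite -leqNgt bigE'.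
  exists (X :\ i); first by rewrite !inE eqxx.
  move: ltX; rewrite (cardsD1 i X) iX (big_setD1 i iX) /= bigE' ?inE ?eqxx //.
  by rewrite /E' eqxx setUC.
(* Rado's argument: if neither [x] nor [y] can be removed from [E i], the two
   violated conditions contradict the submodularity of the neighbourhood size. *)
have [//|[A niA leA]] := step x Ex.
have [//|[B niB leB]] := step y Ey.
have := hallE (i |: (A :|: B)); have := hallE (A :&: B).
set NA := \bigcup_(k in A) E k in leA; set NB := \bigcup_(k in B) E k in leB.
have subI : \bigcup_(k in A :&: B) E k
    \subset (NA :|: E i :\ x) :&: (NB :|: E i :\ y).
  apply/bigcupsP => k /setIP[kA kB]; rewrite subsetI.
  by rewrite !(subset_trans (bigcup_sup k _) (subsetUl _ _)).
(* Since [x] and [y] differ, the two reduced copies of [E i] together cover [E i]. *)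
have subU : \bigcup_(k in i |: (A :|: B)) E k
    \subset (NA :|: E i :\ x) :|: (NB :|: E i :\ y).
  rewrite !bigcup_setU big_set1; apply/subsetP => z; rewrite !inE.
  have [->|_] := eqVneq z x; first by rewrite neq_xy Ex !orbT.
  by case: (z \in E i); case: (z \in NA); case: (z \in NB); rewrite ?orbT.
move/subset_leq_card: subI; move/subset_leq_card: subU.
rewrite cardsU1 !inE negb_or niA niB /=.
have := cardsUI A B; have := cardsUI (NA :|: E i :\ x) (NB :|: E i :\ y).
lia.
Qed.

(** Hall's condition follows by counting the edges that leave [X]: there are [#|X| * d] of them, and
    each neighbour receives at most [d]. *)
Lemma regular_matching (I J : finType) (e : I -> J -> bool) (d : nat) :
    (0 < d)%N -> (forall i, #|[set j | e i j]| = d) ->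
    (forall j, #|[set i | e i j]| = d) ->
  exists2 f : I -> J, injective f & forall i, e i (f i).
Proof.
move=> d_gt0 rowd cold.
have [X | f injf fE] := @hall I J (fun i => [set j | e i j]); last first.
  by exists f => // i; have := fE i; rewrite inE.
set NX := \bigcup_(i in X) _.
rewrite -(leq_pmul2r d_gt0).
have -> : (#|X| * d = \sum_(i in X) \sum_(j in NX) e i j)%N.
  rewrite -sum_nat_const; apply: eq_bigr => i iX.
  rewrite -(rowd i) -sum1_card -big_mkcondr /=; apply: eq_bigl => j.
  rewrite inE andb_idl // => eij; apply/bigcupP; exists i; rewrite ?inE //.
rewrite exchange_big -sum_nat_const leq_sum // => j _.
rewrite -big_mkcondr /= sum1_card -(cold j).
by apply/subset_leq_card/subsetP => i; rewrite !inE => /andP[].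
Qed.

(** * Maximal cliques of the derangement graph *)

Lemma derangement_graphE (N : nat) (s t : 'S_N) :
  derangement_graph s t = [forall i, s i != t i].
Proof.
apply: eq_forallb => i; rewrite permM.
by rewrite -(inj_eq (@perm_inj _ t)) permKV.
Qed.

Lemma derangement_graph_sym (N : nat) : symmetric (@derangement_graph N).
Proof.
by move=> s t; rewrite !derangement_graphE; apply: eq_forallb => i; rewrite eq_sym.
Qed.

Section Clique.
Variables (N : nat) (C : {set 'S_N}).
Hypothesis C_max : maximal_clique (@derangement_graph N) C.

Lemma clique_inj (s t : 'S_N) (i : 'I_N) :
  s \in C -> t \in C -> s i = t i -> s = t.
Proof.
move=> sC tC st; apply/eqP/negPn/negP => neq_st.
have /maxsetP[/forall_inP/(_ s sC)/forall_inP/(_ t tC) + _] := C_max.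
by rewrite neq_st derangement_graphE => /forallP/(_ i); rewrite st eqxx.
Qed.

(* If some [(i, j)] is missed then the missed pairs form a regular bipartite
   graph of positive degree, and a perfect matching of it extends [C]. *)
Lemma maximal_clique_transitive (i j : 'I_N) : exists2 t, t \in C & t i = j.
Proof.
pose e (i j : 'I_N) := [forall t in C, t i != j].
have rowC k : #|[set l | e k l]| = (N - #|C|)%N.
  have -> : [set l | e k l] = ~: [set t k | t : 'S_N in C].
    apply/setP => l; rewrite !inE; apply/forall_inP/negP => [h /imsetP[t tC lE] | h t tC].
      by have := h t tC; rewrite lE eqxx.
    by apply/eqP => lE; apply/h/imsetP; exists t.
  rewrite cardsCs setCK card_ord card_in_imset // => s t sC tC.
  exact: clique_inj.
have colC l : #|[set k | e k l]| = (N - #|C|)%N.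
  have -> : [set k | e k l] = ~: [set (t^-1)%g l | t : 'S_N in C].
    apply/setP => k; rewrite !inE; apply/forall_inP/negP => [h /imsetP[t tC kE] | h t tC].
      by have := h t tC; rewrite kE permKV eqxx.
    by apply/eqP => lE; apply/h/imsetP; exists t; rewrite // -lE permK.
  rewrite cardsCs setCK card_ord card_in_imset // => s t sC tC st.
  by apply: (@clique_inj s t ((s^-1)%g l)) => //; rewrite permKV st permKV.
have [/existsP[t /andP[tC /eqP]] | neij] := boolP [exists t, (t \in C) && (t i == j)].
  by exists t.
have eij : e i j.
  by apply/forall_inP => t tC; apply: contra neij => tij; apply/existsP; exists t; rewrite tC.
have [|f injf fe] := @regular_matching _ _ e (N - #|C|)%N _ rowC colC.
  by rewrite -(rowC i); apply/card_gt0P; exists j; rewrite inE.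
pose s := perm injf.
have es t : t \in C -> derangement_graph s t.
  move=> tC; rewrite derangement_graphE; apply/forallP => k.
  by rewrite permE eq_sym; have /forall_inP/(_ t tC) := fe k.
have /maxsetP[/forall_inP clC maxC] := C_max.
(* By maximality [s] lies in [C], so it would be adjacent to itself. *)
have sC : s \in C.
  rewrite -(maxC (s |: C)) ?setU11 ?subsetUr //.
  apply/forall_inP => x /setU1P[-> | xC]; apply/forall_inP => y /setU1P[-> | yC].
  - by rewrite eqxx.
  - by rewrite es ?implybT.
  - by rewrite derangement_graph_sym es ?implybT.
  - by have /forall_inP := clC x xC; apply.
by have := es s sC; rewrite derangement_graphE => /forallP/(_ i); rewrite eqxx.
Qed.

(** Double counting: for each point [i], exactly one member of [C] agrees with [s] at [i]. *)
Lemma sum_clique_agree (s : 'S_N) : (\sum_(t in C) #|[set i | s i == t i]| = N)%N.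
Proof.
under eq_bigr do rewrite -sum1_card big_mkcond.
rewrite exchange_big /= -[RHS]card_ord -sum1_card; apply: eq_bigr => i _.
have [t tC ti] := maximal_clique_transitive i (s i).
rewrite (bigD1 t) //= inE ti eqxx big1 // => u /andP[uC neq_ut].
rewrite inE; case: eqP => // su; case/eqP: neq_ut.
by apply: (@clique_inj u t i) => //; rewrite ti su.
Qed.

Lemma card_maximal_clique : (0 < N)%N -> #|C| = N.
Proof.
move=> N_gt0; pose i := Ordinal N_gt0.
rewrite -[RHS]card_ord -(@card_in_imset _ _ (fun t : 'S_N => t i) C); last first.
  by move=> s t; exact: clique_inj.
apply: eq_card => j; rewrite inE; have [t tC tj] := maximal_clique_transitive i j.
by apply/imsetP; exists t.
Qed.

Lemma disconnected_agree (A : {set 'S_N}) (s t : 'S_N) : (0 < N)%N ->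
    disconnected (@derangement_graph N) A C -> s \in A -> t \in C ->
  #|[set i | s i == t i]| = 1%N.
Proof.
move=> N_gt0 /forall_inP discA /discA /forall_inP disc_s tC.
have ge1 u : u \in C -> (1 <= #|[set i | s i == u i]|)%N.
  move/disc_s; rewrite derangement_graphE => /forallPn[i].
  by rewrite negbK => sui; apply/card_gt0P; exists i; rewrite inE.
have := sum_clique_agree s.
rewrite -[RHS](card_maximal_clique N_gt0) -sum1_card => /esym sumE.
have /leqif_sum : forall u, u \in C ->
    (1 <= #|[set i | s i == u i]| ?= iff (#|[set i | s i == u i]| == 1))%N.
  by move=> u uC; split; [exact: ge1 | rewrite eq_sym].
by case=> _; rewrite sumE eqxx => /esym/forall_inP/(_ t tC)/eqP.
Qed.
End Clique.

(** * Trace pairings, rank bounds and the factorization of the agreement count *)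

Section LinearAlgebra.
Variable F : fieldType.

Lemma mxtrace_mulmx_mxvec (m n : nat) (A : 'M[F]_(m, n)) (B : 'M[F]_(n, m)) :
  \tr (A *m B) = \sum_k mxvec A 0 k * mxvec B^T 0 k.
Proof.
rewrite [RHS](reindex _ (curry_mxvec_bij m n)) /= /mxtrace.
under [LHS]eq_bigr do rewrite mxE.
by rewrite pair_bigA; apply: eq_bigr => -[i j] _; rewrite !mxvecE mxE.
Qed.

(* The subquotient of the natural representation: [Q = R *m L] is
   [1 - e *m u - w *m f], which kills the span of [e] and [w]. *)
Lemma mxtrace_compress (n : nat) (u f : 'rV[F]_n) (e w : 'cV[F]_n) :
    u *m e = 1%:M -> f *m w = 1%:M -> f *m e = 0 -> u *m w = 0 ->
  exists2 k, (k + 2 <= n)%N & exists (L : 'M[F]_(k, n)) (R : 'M[F]_(n, k)),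
    forall X Y : 'M_n, u *m X = u -> u *m Y = u -> X *m w = w -> Y *m w = w ->
    \tr (X *m Y) = 2 + \tr ((L *m X *m R) *m (L *m Y *m R)).
Proof.
move=> ue fw fe uw; pose Q : 'M_n := 1%:M - e *m u - w *m f.
have uQ : u *m Q = 0.
  by rewrite !mulmxBr !mulmxA ue uw mulmx1 mul1mx mul0mx subrr subr0.
have Qw : Q *m w = 0.
  by rewrite !mulmxBl -!mulmxA fw uw mulmx1 mul1mx mulmx0 subr0 subrr.
have Qe : Q *m e = 0.
  by rewrite !mulmxBl -!mulmxA fe ue mulmx1 mul1mx mulmx0 subrr subr0.
have one : 1%:M = e *m u + w *m f + Q :> 'M_n.
  by rewrite /Q -[X in _ + X]addrA -opprD [RHS]addrC subrK.
clearbody Q; exists (\rank Q).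
  (* [Q] kills the columns [e] and [w], which are independent because pairing them with [u] and [f]
     gives the identity. *)
  have /mulmx0_rank_max : Q *m row_mx e w = 0.
    by rewrite mul_mx_row Qe Qw row_mx0.
  apply: leq_trans; rewrite leq_add2l.
  have <- : \rank (col_mx u f *m row_mx e w) = 2%N.
    by rewrite mul_col_row ue uw fe fw -scalar_mx_block mxrank1.
  exact: mxrankM_maxr.
have := mulmx_base Q; move: (row_base Q) (col_base Q) => L R QE.
exists L, R => X Y uX uY Xw Yw.
(* The decomposition of 1 is inserted before [X], then before [Y]. The rank-one projections [e *m u]
   and [w *m f] contribute 1 each, the cross terms vanish, and [\tr (Q *m X *m Q *m Y)] remains. *)
rewrite -[X in \tr (X *m _)]mul1mx one !mulmxDl !mxtraceD.
have -> : \tr (e *m u *m X *m Y) = 1.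
  by rewrite -!mulmxA mxtrace_mulC !mulmxA uX uY ue mxtrace1.
have -> : \tr (w *m f *m X *m Y) = 1.
  by rewrite -!mulmxA mxtrace_mulC -!mulmxA Yw Xw fw mxtrace1.
congr (_ + _); rewrite -{1}[Y]mul1mx one !mulmxDl !mulmxDr !mxtraceD.
have -> : \tr (Q *m X *m (e *m u *m Y)) = 0.
  by rewrite -(mulmxA e) uY !mulmxA mxtrace_mulC !mulmxA uQ !mul0mx mxtrace0.
have -> : \tr (Q *m X *m (w *m f *m Y)) = 0.
  by rewrite !mulmxA -(mulmxA Q) Xw Qw !mul0mx mxtrace0.
rewrite !add0r -[in LHS]QE -!mulmxA mxtrace_mulC !mulmxA //.
Qed.

(* [A - K *m A'] and [B'] annihilate each other, so [\rank B'] is bounded by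
   the corank of the former, whereas [A] and [A - K *m A'] differ by rank [r]. *)
Lemma rank_isotropic (m n D l r : nat) (A : 'M[F]_(m, D)) (B : 'M[F]_(D, n))
    (B' : 'M[F]_(D, l)) (K : 'M[F]_(m, r)) (A' : 'M[F]_(r, D)) :
    (A - K *m A') *m B' = 0 -> (\rank (A *m B) <= \rank B')%N ->
  ((\rank (A *m B)).*2 <= D + r)%N.
Proof.
move=> /mulmx0_rank_max le_D le_B'.
have : (\rank (A *m B) <= \rank (A - K *m A')%R + r)%N.
  rewrite -{1}[A](subrK (K *m A')) mulmxDl (leq_trans (mxrank_add _ _)) //.
  by rewrite leq_add ?mxrankM_maxl // -mulmxA (leq_trans (mxrankM_maxl _ _)) ?rank_leq_col.
lia.
Qed.

(** A basis of the row space of the value matrix, read back as the functions [psi], spans every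
    [v s]. *)
Lemma dim_span_le_rank (T I : finType) (S : {set I}) (v : I -> {ffun T -> F^o}) :
  (\dim <<[seq v s | s in S]>>%VS
     <= \rank (\matrix_(a < #|S|, b < #|T|) (v (enum_val a) (enum_val b) : F)))%N.
Proof.
set G := (\matrix_(_, _) _).
pose psi i : {ffun T -> F^o} := [ffun t => row_base G i (enum_rank t)].
pose X := [seq psi i | i : 'I_(\rank G)].
have sz : size X = \rank G by rewrite size_image card_ord.
rewrite -[leqRHS]sz (leq_trans _ (dim_span X)) // dimvS //.
apply/span_subvP => _ /imageP[s sS ->].
have /submxP[c cE] : (row (enum_rank_in sS s) G <= row_base G)%MS.
  by rewrite eq_row_base row_sub.
have -> : v s = \sum_i c 0 i *: psi i.
  apply/ffunP => t; rewrite sum_ffunE.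
  have /matrixP/(_ 0 (enum_rank t)) := cE.
  rewrite !mxE enum_rankK_in // enum_rankK => ->.
  by apply: eq_bigr => i _; rewrite !ffunE.
by apply: memv_suml => i _; rewrite memvZ // memv_span // image_f.
Qed.

Lemma mxtrace_perm_mxV (N : nat) (s t : 'S_N) :
  \tr (perm_mx (s * t^-1)%g) = #|[set i | s i == t i]|%:R :> F.
Proof.
rewrite -sum1_card natr_sum big_mkcond; apply: eq_bigr => i _.
by rewrite !mxE inE permM (can2_eq (permKV t) (permK t)); case: eqP.
Qed.

Lemma P_nat_indicator (N : nat) (s t : 'S_N) :
  P_nat (indicator F s) t = #|[set i | s i == t i]|%:R.
Proof.
rewrite ffunE (bigD1 s) //= big1 => [|x neq_xs]; rewrite ffunE.
  by rewrite eqxx mul1r addr0 mxtrace_perm_mxV.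
by rewrite (negPf neq_xs) mul0r.
Qed.

Lemma agree_factor (N : nat) : (1 < N)%N -> N%:R = 0 :> F ->
  exists2 D, (D <= (N - 2) ^ 2 + 1)%N &
  exists al be : 'S_N -> 'I_D -> F, forall s t,
    \sum_d al s d * be t d = #|[set i | s i == t i]|%:R.
Proof.
move=> N_gt1 N0; pose i0 := Ordinal (ltnW N_gt1); pose i1 := Ordinal N_gt1.
(* The all-ones vectors are fixed by permutation matrices, and [u *m w] is [N], which is 0 in [F].
   Two distinct points, available as [1 < N], make [f *m e] vanish. *)
pose u : 'rV[F]_N := const_mx 1; pose w : 'cV[F]_N := const_mx 1.
pose e : 'cV[F]_N := delta_mx i0 0; pose f : 'rV[F]_N := delta_mx 0 i1.
have [||||k le_k [L [R LR]]] := @mxtrace_compress N u f e w.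
- by apply/matrixP => i j; rewrite !ord1 -colE !mxE.
- by apply/matrixP => i j; rewrite !ord1 -rowE !mxE.
- by rewrite mul_delta_mx_0.
- apply/matrixP => i j; rewrite !mxE.
  by under eq_bigr do rewrite !mxE mul1r; rewrite sumr_const card_ord.
have us (s : 'S_N) : u *m perm_mx s = u.
  by rewrite -[s]invgK -col_permE; apply/matrixP => i j; rewrite !mxE.
have sw (s : 'S_N) : perm_mx s *m w = w.
  by rewrite -row_permE; apply/matrixP => i j; rewrite !mxE.
exists (1 + k * k)%N; first by rewrite addnC leq_add2r; nia.
(* The first coordinate carries the constant 2 of the two trivial factors; the other [k * k] are
   matrix entries on the middle factor. *)
exists (fun s => row_mx (1%:M : 'M_1) (mxvec (L *m perm_mx s *m R)) 0).
exists (fun t => row_mx (2%:M : 'M_1) (mxvec (L *m perm_mx t^-1 *m R)^T) 0).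
move=> s t; rewrite -mxtrace_perm_mxV perm_mxM LR // big_split_ord /= big_ord1.
rewrite !row_mxEl !mxE mul1r mxtrace_mulmx_mxvec; congr (_ + _).
by apply: eq_bigr => d _; rewrite !row_mxEr.
Qed.

End LinearAlgebra.

Theorem theorem2p7 (F : finFieldType) (p N r : nat)
    (charF : p \in [pchar F]) (p_dvd_N : (p %| N)%N)
    (C : 'I_r -> {set 'S_N})
    (C_max : forall i, maximal_clique (@derangement_graph N) (C i))
    (C_disc : mutually_disconnected (@derangement_graph N) C) :
  (\dim <<[seq P_nat (indicator F s) | s in \bigcup_(i < r) C i]>>%VS)%:R
    <= (N%:R ^+ 2 - 4 * N%:R + r%:R + 5) / 2 :> rat.
Proof.
(* The value 0 is divisible by [p] too: there is then a single permutation, and the bound is at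
   least 5/2. *)
have [N0 | N_gt0] := posnP N.
  apply: (@le_trans _ _ 1).
    rewrite (ler_nat _ _ 1) (leq_trans (dim_span _)) // size_image.
    by rewrite (leq_trans (max_card _)) // card_Sn N0.
  have : 0 <= r%:R :> rat by [].
  rewrite N0; lra.
have N_gt1 : (1 < N)%N.
  exact: leq_trans (prime_gt1 (pcharf_prime charF)) (dvdn_leq N_gt0 p_dvd_N).
have NF0 : N%:R = 0 :> F by apply/eqP; rewrite -(dvdn_pcharf charF).
pose fx (s t : 'S_N) := #|[set i | s i == t i]|.
have fxE i j s t : s \in C i -> t \in C j ->
    (fx s t)%:R = (i != j)%:R :> F.
  move=> sC tC; have [eq_ij | neq_ij] := eqVneq i j; last first.
    by rewrite /fx (disconnected_agree (C_max j) N_gt0 (C_disc _ _ neq_ij)).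
  have [-> | neq_st] := eqVneq s t.
    have -> : fx t t = N; last exact: NF0.
    by rewrite -[RHS]card_ord; apply: eq_card => k; rewrite !inE eqxx.
  rewrite /fx eq_card0 // => k; rewrite inE; apply/eqP => st.
  rewrite -eq_ij in tC; case/eqP: neq_st.
  exact: (clique_inj (C_max i) sC tC st).
have [D le_D [al [be alE]]] := agree_factor N_gt1 NF0.
set S := \bigcup_(i < r) C i.
have cl (s : 'I_#|S|) : {i | enum_val s \in C i}.
  by apply: sigW; have /bigcupP[i _ sC] := enum_valP s; exists i.
have rep i : {t | t \in C i}.
  by apply: sigW; apply/card_gt0P; rewrite (card_maximal_clique (C_max i)).
pose A : 'M[F]_(#|S|, D) := \matrix_(a, d) al (enum_val a) d.
pose B : 'M[F]_(D, #|{: 'S_N}|) := \matrix_(d, b) be (enum_val b) d.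
pose B' : 'M[F]_(D, #|S|) := \matrix_(d, b) be (enum_val b) d.
pose K : 'M[F]_(#|S|, r) := \matrix_(a, i) (i == sval (cl a))%:R.
pose A' : 'M[F]_(r, D) := \matrix_(i, d) al (sval (rep i)) d.
(* Each row of [A - K *m A'] is thus the difference between a permutation and the base point of its
   clique; [fxE] depends only on the cliques, so it is orthogonal to [B']. *)
have KA' : K *m A' = \matrix_(a, d) al (sval (rep (sval (cl a)))) d.
  apply/matrixP => a d; rewrite !mxE (bigD1 (sval (cl a))) //= big1 => [|i neq_i].
    by rewrite !mxE eqxx mul1r addr0.
  by rewrite !mxE (negPf neq_i) mul0r.
have ort : (A - K *m A') *m B' = 0.
  rewrite KA' mulmxBl; apply/matrixP => a b; rewrite !mxE.
  under eq_bigr do rewrite !mxE; under [X in _ - X]eq_bigr do rewrite !mxE.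
  rewrite !alE -/(fx _ _) -/(fx _ _).
  rewrite (fxE _ _ _ _ (svalP (cl a)) (svalP (cl b))).
  by rewrite (fxE _ _ _ _ (svalP (rep _)) (svalP (cl b))) subrr.
have fx_sym s t : fx s t = fx t s.
  by apply: eq_card => i; rewrite !inE eq_sym.
(* The pairing is symmetric, so the transpose of [A *m B] also factors through [B']. *)
have le_rank : (\rank (A *m B) <= \rank B')%N.
  pose AT : 'M[F]_(#|{: 'S_N}|, D) := \matrix_(a, d) al (enum_val a) d.
  rewrite -mxrank_tr -[X in (\rank X <= _)%N](_ : AT *m B' = _) ?mxrankM_maxr //.
  apply/matrixP => a b; rewrite !mxE.
  under eq_bigr do rewrite !mxE.
  under [RHS]eq_bigr do rewrite !mxE.
  by rewrite !alE -/(fx _ _) fx_sym.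
have := rank_isotropic ort le_rank.
have dimE := dim_span_le_rank S (fun s => P_nat (indicator F s)).
move/(leq_trans _) => /(_ (\dim <<[seq P_nat (indicator F s) | s in S]>>%VS).*2).
have -> : A *m B = \matrix_(a < #|S|, b < #|{: 'S_N}|)
    (P_nat (indicator F (enum_val a)) (enum_val b) : F).
  apply/matrixP => a b; rewrite !mxE P_nat_indicator -alE.
  by apply: eq_bigr => d _; rewrite !mxE.
rewrite leq_double => /(_ dimE) le_dim.
(* The term [4 * N] stands on the left to avoid truncated subtraction. *)
have : ((\dim <<[seq P_nat (indicator F s) | s in S]>>%VS) * 2 + 4 * N <= N ^ 2 + r + 5)%N.
  nia.
rewrite -(ler_nat rat) !natrD !natrM; lra.
Qed.
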